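(* Let $n\ge 1$ and let $w_1,\ldots,w_n$ be positive real numbers with $\sum_{j=1}^n w_j\ge 1$. Let $d_{j,k}$ ($1\le j\le n$, $k\ge 1$) be real numbers with $d_{j,k}\ge 1$ for all $j=1,\ldots,n$ and $k\ge 1$, and suppose that for every $j=1,\ldots,n$ the limit $\lim_{k\to\infty}d_{j,k}=d_j$ exists (as a real number) with $d_j>1$. Let $b_0:=1$ and $b_k:=\sum_{j=1}^n w_jd_{j,k}^{\,k}$ for $k\ge 1$. Then $\lim_{k\to\infty}b_k^{1/k}=\max_{1\le j\le n}d_j$. *)

(* Defs.v *)
From HB Require Import structures.
From mathcomp Require Import all_boot all_order all_algebra.
From mathcomp Require Import all_classical all_reals all_analysis.

Set Implicit Arguments.
Unset Strict Implicit.
Unset Printing Implicit Defensive.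

Import Order.TTheory GRing.Theory Num.Theory.
Import numFieldNormedType.Exports.

Local Open Scope ring_scope.

(* The values d j 0 are never used: the family d_{j,k} is only given for
   k >= 1, and the term of index 0 is 1 by convention. *)
Definition weighted_power_sum (R : realType) (n : nat) (w : 'I_n -> R)
    (d : 'I_n -> nat -> R) (k : nat) : R :=
  if k == 0%N then 1 else \sum_(j < n) w j * d j k ^+ k.

(* Seeding the iterated maximum with the value at index 0, rather than with an
   ad hoc constant, makes it the maximum of x over 'I_n for every x. *)
Definition family_max (R : realType) (n : nat) (hn : (1 <= n)%N)
    (x : 'I_n -> R) : R :=
  \big[Num.max/x (Ordinal hn)]_(j < n) x j.

(* Main.v *)
Require Import Defs.
From HB Require Import structures.
From mathcomp Require Import all_boot all_order all_algebra.
From mathcomp Require Import all_classical all_reals all_analysis.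

Set Implicit Arguments.
Unset Strict Implicit.
Unset Printing Implicit Defensive.

Import Order.TTheory GRing.Theory Num.Theory.
Import numFieldNormedType.Exports.

Local Open Scope classical_set_scope.
Local Open Scope ring_scope.

(* Bounding the sum below by the single term of an index [m] where [dlim] is
   maximal, and above by all the weights times the [k]-th power of
   [max_j d_{j,k}], gives
   [w_m^(1/k) d_{m,k} <= b_k^(1/k) <= (sum_j w_j)^(1/k) max_j d_{j,k}],
   and both outer sequences tend to the maximum of [dlim]. *)

(** Since [c > 0], the root is [expR (ln c / k)]; its argument tends to [0] and [expR] is
    continuous. *)
Lemma cvg_powR_invn1 (R : realType) (c : R) : 0 < c ->
  c `^ (k%:R^-1) @[k --> \oo] --> (1 : R).
Proof.
move=> c_gt0.
have -> : (fun k : nat => c `^ (k%:R^-1)) =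
          (fun k : nat => expR (k%:R^-1 * ln c)).
  by apply/funext => k; rewrite /powR gt_eqF.
rewrite -[X in _ --> X]expR0 -(mul0r (ln c)).
apply: continuous_cvg; first exact: continuous_expR.
apply: cvgM; last exact: cvg_cst.
(* The harmonic sequence is [1/(k+1)], hence the shift by one index. *)
rewrite -(cvg_shiftS (fun k : nat => (k%:R : R)^-1)).
exact: cvg_harmonic.
Qed.

(** Puts each outer bound under a single [k]-th root, so that only radicands remain to be
    compared. *)
Lemma powR_scale_root (R : realType) (c x : R) (k : nat) :
  (0 < k)%N -> 0 <= c -> 0 <= x ->
  (c * x ^+ k) `^ (k%:R^-1) = c `^ (k%:R^-1) * x.
Proof.
move=> k_gt0 c_ge0 x_ge0.
rewrite powRM ?exprn_ge0// -powR_mulrn// -powRrM mulfV ?powRr1//.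
by rewrite pnatr_eq0 -lt0n.
Qed.

Theorem corollary1 (R : realType) (n : nat) (hn : (1 <= n)%N)
  (w : 'I_n -> R) (w_gt0 : forall j, 0 < w j)
  (w_sum : 1 <= \sum_(j < n) w j)
  (d : 'I_n -> nat -> R)
  (d_ge1 : forall j k, (1 <= k)%N -> 1 <= d j k)
  (dlim : 'I_n -> R)
  (d_cvg : forall j, d j k @[k --> \oo] --> dlim j)
  (dlim_gt1 : forall j, 1 < dlim j) :
  weighted_power_sum w d k `^ (k%:R^-1) @[k --> \oo] --> family_max hn dlim.
Proof.
have d_ge0 j k : (0 < k)%N -> 0 <= d j k.
  by move=> /(d_ge1 j); apply: le_trans.
have [m maxE] : exists m, family_max hn dlim = dlim m.
  (* Being a value of [dlim] holds for the seed and is preserved by [Num.max]. *)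
  rewrite /family_max; elim/big_ind: _ => [|x y [i ->] [j ->]|j _].
  - by exists (Ordinal hn).
  - by case: (leP (dlim i) (dlim j)) => _; [exists j | exists i].
  - by exists j.
(* Seeding with a constant keeps the same limit and still dominates d_{j,k}. *)
pose D k := \big[Num.max/dlim (Ordinal hn)]_(j < n) d j k.
have cvgD : D k @[k --> \oo] --> family_max hn dlim.
  by apply: cvg_big => //; exact: max_continuous.
have W_gt0 : 0 < \sum_(j < n) w j by exact: lt_le_trans w_sum.
apply: (@squeeze_cvgr _ _ _ _ (fun k => w m `^ (k%:R^-1) * d m k)
                     (fun k => (\sum_(j < n) w j) `^ (k%:R^-1) * D k)).
(* The bounds can fail at [k = 0], where the lower one reads [d m 0], on which [d_ge1] says
   nothing. *)
- exists 1%N => // k /= k_gt0.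
  have D_ge0 : 0 <= D k.
    exact: le_trans (d_ge0 m k k_gt0) (le_bigmax _ (d^~ k) m).
  have term_ge0 j : 0 <= w j * d j k ^+ k.
    by rewrite mulr_ge0 ?exprn_ge0 ?d_ge0 ?(ltW (w_gt0 j)).
  have b_ge0 : 0 <= \sum_(j < n) w j * d j k ^+ k by exact: sumr_ge0.
  rewrite /weighted_power_sum gtn_eqF//.
  rewrite -(powR_scale_root k_gt0 (ltW (w_gt0 m)) (d_ge0 m k k_gt0)).
  rewrite -(powR_scale_root k_gt0 (ltW W_gt0) D_ge0).
  have kV_ge0 : 0 <= k%:R^-1 :> R by rewrite invr_ge0.
  (* The [k]-th root is monotone on nonnegative reals. *)
  apply/andP; split; apply: ge0_ler_powR; rewrite // ?nnegrE//.
  + by rewrite (bigD1 m)//= lerDl sumr_ge0.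
  + by rewrite mulr_ge0 ?exprn_ge0// ltW.
  + rewrite mulr_suml ler_sum// => j _.
    by rewrite ler_pM2l// lerXn2r ?nnegrE ?d_ge0// (le_bigmax _ (d^~ k)).
- rewrite maxE -[dlim m]mul1r; apply: cvgM; last exact: d_cvg.
  exact: cvg_powR_invn1.
- rewrite -[family_max _ _]mul1r; apply: cvgM => //.
  exact: cvg_powR_invn1.
Qed.
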